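(* Let $n$ be a positive integer. Then the following congruence holds modulo $\Phi_n(q)^2$: $$\sum_{k=0}^{n-1}q^{k+1}\left[{2k\atop k+1}\right]\equiv\begin{cases}q^{\frac{n(2n-1)}{3}} & \text{if } n\equiv 2\pmod 3,\\[5pt] \frac{n-1}{3}(q^n-1) & \text{if } n\equiv 1\pmod 3.\end{cases}$$ (No assertion is made when $n\equiv 0\pmod 3$.)
   Context: Here $q$ is an indeterminate. The $q$-shifted factorial is $(a;q)_m=(1-a)(1-aq)\cdots(1-aq^{m-1})$ for $m\ge 1$ and $(a;q)_0=1$. The $q$-binomial coefficient is $\left[{m\atop k}\right]=\frac{(q;q)_m}{(q;q)_k(q;q)_{m-k}}$ if $0\le k\le m$, and $0$ otherwise (in particular $\left[{0\atop 1}\right]=0$); it is a polynomial in $q$ with integer coefficients. $\Phi_n(q)=\prod_{1\le j\le n,\ \gcd(n,j)=1}(q-e^{2\pi i j/n})$ is the $n$th cyclotomic polynomial. The congruence is between polynomials in $\mathbb{Z}[q]$: $A(q)\equiv B(q)\pmod{\Phi_n(q)^2}$ means that $\Phi_n(q)^2$ divides $A(q)-B(q)$ in $\mathbb{Z}[q]$ (equivalently in $\mathbb{Q}[q]$, as $\Phi_n$ is monic). *)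

(* Defs.v *)
From mathcomp Require Import all_boot all_order all_algebra all_field.
From mathcomp Require Import ring.
Set Implicit Arguments.
Unset Strict Implicit.
Unset Printing Implicit Defensive.
Import GRing.Theory.
Local Open Scope ring_scope.

(* The indeterminate q is 'X : {poly int}. *)

Definition qpoch (R : comNzRingType) (a q : R) (m : nat) : R :=
  \prod_(0 <= i < m) (1 - a * q ^+ i).

(* %/ is polynomial division over int; the divisor has leading coefficient 1 or -1, so
   this is genuine Euclidean division, and it is exact by qbinomE below. *)
Definition qbinom (m k : nat) : {poly int} :=
  if (k <= m)%N then
    qpoch 'X 'X m %/ (qpoch 'X 'X k * qpoch 'X 'X (m - k))
  else 0.

Definition polyz_congr (D A B : {poly int}) : Prop :=
  exists C : {poly int}, A - B = C * D.

Lemma qpochS m :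
  qpoch 'X 'X m.+1 = qpoch 'X 'X m * (1 - 'X ^+ m.+1) :> {poly int}.
Proof. by rewrite /qpoch big_nat_recr //= -exprS. Qed.

Lemma lead_coef_qpoch_unit m :
  lead_coef (qpoch 'X 'X m : {poly int}) \is a GRing.unit.
Proof.
elim: m => [|m IHm]; first by rewrite /qpoch big_geq // lead_coef1 unitr1.
rewrite qpochS lead_coefM unitrM IHm /= -opprB lead_coefN.
by rewrite (monicP (monicXnsubC 1 (ltn0Sn m))).
Qed.

Lemma qpoch_exact k j : exists C : {poly int},
  qpoch 'X 'X (k + j) = C * (qpoch 'X 'X k * qpoch 'X 'X j).
Proof.
have qp0 : qpoch 'X 'X 0 = 1 :> {poly int} by rewrite /qpoch big_geq.
elim: k j => [|k IHk] j; first by exists 1; rewrite qp0 !mul1r.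
elim: j => [|j [C1 E1]]; first by exists 1; rewrite addn0 qp0 mulr1 mul1r.
have [C2 E2] := IHk j.+1.
exists (C1 + 'X ^+ j.+1 * C2).
have -> : qpoch 'X 'X (k.+1 + j.+1) = qpoch 'X 'X (k.+1 + j) * (1 - 'X ^+ j.+1)
   + 'X ^+ j.+1 * qpoch 'X 'X (k + j.+1) * (1 - 'X ^+ k.+1) :> {poly int}.
  have -> : (k.+1 + j.+1 = (k + j.+1).+1)%N by [].
  by rewrite qpochS -addSn exprD addSnnS; ring.
by rewrite E1 E2 !qpochS; ring.
Qed.

Lemma qbinomE m k : (k <= m)%N ->
  qbinom m k * (qpoch 'X 'X k * qpoch 'X 'X (m - k)) = qpoch 'X 'X m.
Proof.
move=> le_km; rewrite /qbinom le_km.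
have [C] := qpoch_exact k (m - k); rewrite subnKC // => ->.
by rewrite Pdiv.IdomainUnit.mulpK // lead_coefM unitrM !lead_coef_qpoch_unit.
Qed.

(* Main.v *)
(* Write S_n for the sum.  Two finite pentagonal-type expansions, obtained by
   telescoping over n, hold exactly in Z[q]:
     S_n = sum_(m >= 0) q^((3m+2)(2m+1)) [2n, n+3m+2] - q^((6m+7)(m+1)) [2n, n+3m+3],
     S_n = -1 + sum_(m >= 0) q^(m(6m-1)) [2n, n+3m] - q^((2m+1)(3m+1)) [2n, n+3m+1].
   By the q-Vandermonde identity, [2n, k] = [n, k] (1 + q^(nk)) mod Phi_n^2 for
   0 < k <= n, and Phi_n divides [n, k] for 0 < k < n.  Hence [2n, n+j] and [2n, n+j']
   agree mod Phi_n^2 when j + j' = n with j, j' > 0.  Under this reflection, which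
   matches the exponents of q modulo n, the two residue classes of j mod 3 in the first
   expansion cancel if n = 2 mod 3, leaving the term j = n; those in the second one
   cancel if n = 1 mod 3, leaving
     -1 + [2n, n] - q^((2N+1)n) = q^(n^2) - q^((2N+1)n),  N = (n-1)/3,
   which is N (q^n - 1) mod Phi_n^2 because Phi_n divides q^n - 1. *)
Require Import Defs.
From mathcomp Require Import all_boot all_order all_algebra all_field.
From mathcomp Require Import ring zify.
Set Implicit Arguments.
Unset Strict Implicit.
Unset Printing Implicit Defensive.
Import GRing.Theory.
Local Open Scope ring_scope.

Lemma eq_mod_of_add n c d a b : (c * n + a = d * n + b)%N -> a = b %[mod n].
Proof. by move=> E; rewrite -(modnMDl c a) E modnMDl. Qed.

Local Notation q := ('X : {poly int}).
Local Notation qp m := (qpoch 'X 'X m : {poly int}).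

(** * Pascal rules and the q-Vandermonde identity *)

Lemma qpoch0 : qp 0 = 1.
Proof. by rewrite /qpoch big_geq. Qed.

Lemma qpoch_neq0 m : qp m != 0.
Proof.
by have := lead_coef_qpoch_unit m; apply: contraTneq => ->; rewrite lead_coef0 unitr0.
Qed.

Lemma qbinom_gt m k : (m < k)%N -> qbinom m k = 0.
Proof. by rewrite ltnNge /qbinom => /negbTE->. Qed.

Lemma qbinom_sym m k : (k <= m)%N -> qbinom m (m - k) = qbinom m k.
Proof. by move=> le_km; rewrite /qbinom leq_subr le_km subKn // mulrC. Qed.

Lemma qbinom0 m : qbinom m 0 = 1.
Proof.
apply: (mulIf (qpoch_neq0 m)).
by have := @qbinomE m 0 isT; rewrite qpoch0 subn0 !mul1r.
Qed.

Lemma qbinomnn m : qbinom m m = 1.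
Proof. by rewrite -qbinom_sym // subnn qbinom0. Qed.

Lemma qbinom_ratio m k :
  (1 - q ^+ k.+1) * qbinom m k.+1 = (1 - q ^+ (m - k)) * qbinom m k.
Proof.
have [lt_km | le_mk] := ltnP k m; last first.
  (* Here [m <= k] is by definition [m - k == 0], so the factor [1 - q ^+ (m - k)] vanishes. *)
  rewrite (eqP le_mk) subrr mul0r qbinom_gt ?mulr0 //.
apply: (mulIf (mulf_neq0 (qpoch_neq0 k) (qpoch_neq0 (m - k.+1)))).
have Ek := qbinomE (ltnW lt_km); have := qbinomE lt_km.
have E : (m - k = (m - k.+1).+1)%N by rewrite subnSK.
rewrite E !qpochS in Ek * => Ek1.
transitivity (qp m); first by rewrite -Ek1; ring.
by rewrite -Ek; ring.
Qed.

(** Over the common denominator this is 1 - q^(m+1) = (1 - q^(k+1)) + q^(k+1) (1 - q^(m-k)). *)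
Lemma qbinomS m k :
  qbinom m.+1 k.+1 = qbinom m k + q ^+ k.+1 * qbinom m k.+1.
Proof.
have [lt_km | le_mk] := ltnP k m; last first.
  rewrite (@qbinom_gt m k.+1) // mulr0 addr0.
  move: le_mk; rewrite leq_eqVlt => /predU1P[->|lt_mk]; first by rewrite !qbinomnn.
  by rewrite !qbinom_gt.
apply: (mulIf (mulf_neq0 (qpoch_neq0 k.+1) (qpoch_neq0 (m - k)))).
have Ek := qbinomE (ltnW lt_km); have Ek1 := qbinomE lt_km.
have := @qbinomE m.+1 k.+1 (ltnW lt_km); rewrite subSS => ->.
have E : (m - k = (m - k.+1).+1)%N by rewrite subnSK.
have Em : (m.+1 = k.+1 + (m - k.+1).+1)%N by lia.
rewrite mulrDl -[q ^+ _ * _ * _]mulrA.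
rewrite E {1}qpochS (qpochS (m - k.+1)) in Ek *.
transitivity ((1 - q ^+ k.+1) * qp m + q ^+ k.+1 * (1 - q ^+ (m - k.+1).+1) * qp m).
  by rewrite qpochS Em exprD; ring.
by rewrite -{1}Ek -Ek1 (qpochS k); ring.
Qed.

Lemma qbinomS_dual m k :
  qbinom m.+1 k.+1 = qbinom m k.+1 + q ^+ (m - k) * qbinom m k.
Proof.
rewrite qbinomS; apply/eqP; rewrite -subr_eq0.
set d := _ - _; have -> : d = (1 - q ^+ (m - k)) * qbinom m k
    - (1 - q ^+ k.+1) * qbinom m k.+1 by rewrite /d; ring.
by rewrite qbinom_ratio subrr.
Qed.

(** Induction on [n]: the dual Pascal rule is applied to the left side and to each factor
    [n+1, k+1-i] on the right. *)
Lemma q_Vandermonde m n k :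
  qbinom (m + n) k =
  \sum_(i < k.+1) qbinom m i * qbinom n (k - i) * q ^+ ((m - i) * (k - i)).
Proof.
elim: n k => [|n IHn] k.
  rewrite addn0 big_ord_recr /= subnn muln0 qbinom0 !mulr1 big1 ?add0r // => i _.
  by rewrite [qbinom 0 _]qbinom_gt ?mulr0 ?mul0r // subn_gt0.
case: k => [|k]; first by rewrite big_ord_recl big_ord0 !qbinom0 muln0 !mulr1 addr0.
rewrite addnS qbinomS_dual !IHn big_ord_recr [RHS]big_ord_recr /= subnn !qbinom0.
rewrite [RHS]addrC [X in X + _ = _]addrC -addrA; congr (_ + _).
rewrite mulr_sumr -big_split /=; apply: eq_bigr => -[i /= lt_ik] _.
have E : (k.+1 - i = (k - i).+1)%N by lia.
rewrite E qbinomS_dual mulrDr mulrDl; congr (_ + _).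
have [lt_mi | le_im] := ltnP m i; first by rewrite [qbinom m i]qbinom_gt // !(mul0r, mulr0).
have [lt_nk | le_kn] := ltnP n (k - i).
  by rewrite [qbinom n _]qbinom_gt // !(mul0r, mulr0).
have -> : (m + n - k = (m - i) + (n - (k - i)))%N by lia.
by rewrite mulnS !exprD; ring.
Qed.

(** * Increments in n of the coefficients [2n, n+j] *)

Local Notation cbin n j := (qbinom (2 * n) (n + j)).

Lemma cbin_gt n j : (n < j)%N -> cbin n j = 0.
Proof. by move=> lt_nj; rewrite qbinom_gt // mul2n -addnn ltn_add2l. Qed.

Lemma cbinS n j :
  cbin n.+1 j.+1 - cbin n j.+1 =
  q ^+ (n + j + 2) * cbin n j.+2 + q ^+ (2 * n + 1) * cbin n j.+1
  + q ^+ (n - j) * cbin n j.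
Proof.
have -> : (2 * n.+1 = (2 * n).+2)%N by lia.
have -> : (n.+1 + j.+1 = (n + j).+2)%N by lia.
have -> : (n + j.+1 = (n + j).+1)%N by lia.
have -> : (n + j.+2 = (n + j).+2)%N by lia.
rewrite qbinomS_dual !qbinomS.
have -> : (n + j + 2 = (n + j).+2)%N by lia.
have [lt_nj | le_jn] := ltnP n j.
  by rewrite !(@qbinom_gt (2 * n)) ?(mulr0, addr0, subr0) //; lia.
have -> : ((2 * n).+1 - (n + j).+1 = n - j)%N by lia.
have -> : (2 * n + 1 = (n - j) + (n + j).+1)%N by lia.
by rewrite exprD; ring.
Qed.

(** The case j = -1 of [cbinS]: by symmetry [2n, n-1] = [2n, n+1], whence the coefficient 2. *)
Lemma cbinS0 n :
  cbin n.+1 0 - cbin n 0 =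
  q ^+ (2 * n + 1) * cbin n 0 + 2%:R * q ^+ n.+1 * cbin n 1.
Proof.
have Esym : forall i, (i <= n)%N -> qbinom (2 * n) (n - i) = cbin n i.
  by move=> i le_in; rewrite -qbinom_sym; [congr qbinom|]; lia.
case: n Esym => [|n] Esym.
  rewrite (@qbinomS 1 0 : cbin 1 0 = _) (@qbinom_gt _ (0 + 1)) //.
  by rewrite !qbinom0 qbinomnn !(mulr1, mulr0, addr0) addrAC subrr add0r.
have E1 := Esym 1 isT; rewrite subn1 /= in E1.
have -> : (2 * n.+2 = (2 * n.+1).+2)%N by lia.
rewrite !addn0 !addn1 qbinomS_dual !(qbinomS (2 * n.+1)) {}E1 addn1.
have -> : ((2 * n.+1).+1 - n.+1 = n.+2)%N by lia.
have E : ((2 * n.+1).+1 = n.+2 + n.+1)%N by lia.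
rewrite [in X in _ = X + _]E.
by rewrite exprD; ring.
Qed.

(* Two consecutive increments, in n, combined so that the middle terms cancel by
   [qbinom_ratio] and only the outer ones remain to telescope. *)
Lemma cbin_block n j :
  (cbin n.+1 j.+1 - cbin n j.+1) - q ^+ (2 * j + 3) * (cbin n.+1 j.+2 - cbin n j.+2) =
  q ^+ (n - j) * cbin n j - q ^+ (n + 3 * j + 6) * cbin n j.+3.
Proof.
rewrite !cbinS.
have [le_nj | lt_jn] := leqP n j.
  by rewrite !(@cbin_gt n j.+1, @cbin_gt n j.+2, @cbin_gt n j.+3) ?(mulr0, addr0, add0r) //; lia.
have := qbinom_ratio (2 * n) (n + j.+1); rewrite -addnS => Er.
have E : (n - j = (n - j.+1).+1)%N by lia.
have E1 : (2 * n - (n + j.+1) = n - j.+1)%N by lia.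
rewrite {}E1 !mulrBl !mul1r in Er.
have -> : (n + 3 * j + 6 = (2 * j + 3) + (n + j.+1 + 2))%N by lia.
have {}Er : cbin n j.+2 = q ^+ (n + j.+2) * cbin n j.+2 + (cbin n j.+1 - q ^+ (n - j.+1) * cbin n j.+1).
  by rewrite -Er; ring.
have -> : (n + j + 2 = n + j.+2)%N by lia.
have E2 : q ^+ (2 * n + 1) = q ^+ (n + j.+2) * q ^+ (n - j.+1) by rewrite -exprD; congr (_ ^+ _); lia.
have E3 : q ^+ (2 * j + 3) * q ^+ (2 * n + 1) = q ^+ (n + j.+2) * q ^+ (n + j.+2).
  by rewrite -!exprD; congr (_ ^+ _); lia.
have E4 : q ^+ (2 * j + 3) * q ^+ (n - j.+1) = q ^+ (n + j.+2).
  by rewrite -!exprD; congr (_ ^+ _); lia.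
rewrite !mulrDr !mulrA E3 E4 {1}Er E2 [in X in _ = _ - X]exprD; ring.
Qed.

(** The free offset [a] makes blocks telescope: the last term for (j, a) is the first one for (j +
    3, a + 4j + 6). *)
Lemma cbin_block_exp n j a :
  (q ^+ (a + j) * cbin n.+1 j.+1 - q ^+ (a + 3 * j + 3) * cbin n.+1 j.+2)
  - (q ^+ (a + j) * cbin n j.+1 - q ^+ (a + 3 * j + 3) * cbin n j.+2) =
  q ^+ (a + n) * cbin n j - q ^+ (a + n + 4 * j + 6) * cbin n j.+3.
Proof.
have -> : q ^+ (a + n) * cbin n j = q ^+ (a + j) * (q ^+ (n - j) * cbin n j).
  have [le_jn | lt_nj] := leqP j n; last by rewrite cbin_gt // !mulr0.
  by rewrite mulrA -exprD; congr (_ ^+ _ * _); lia.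
have -> : (a + n + 4 * j + 6 = (a + j) + (n + 3 * j + 6))%N by lia.
have -> : (a + 3 * j + 3 = (a + j) + (2 * j + 3))%N by lia.
rewrite !(exprD q (a + j)) -[in RHS]mulrA -[RHS]mulrBr -cbin_block; ring.
Qed.

(** The block for j = -1, which starts the telescoping of the second expansion. *)
Lemma cbin_block0 n :
  (cbin n.+1 0 - cbin n 0) - q * (cbin n.+1 1 - cbin n 1) =
  q ^+ n.+1 * cbin n 1 - q ^+ (n + 3) * cbin n 2.
Proof.
rewrite cbinS0 cbinS addn0 subn0.
have := qbinom_ratio (2 * n) n.
have -> : (2 * n - n = n)%N by lia.
rewrite !mulrBl !mul1r !addn1 => Er.
have {}Er : q ^+ n * qbinom (2 * n) n =
    qbinom (2 * n) n - qbinom (2 * n) n.+1 + q ^+ n.+1 * qbinom (2 * n) n.+1.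
  have -> : q ^+ n * qbinom (2 * n) n =
    qbinom (2 * n) n - (qbinom (2 * n) n - q ^+ n * qbinom (2 * n) n) by ring.
  by rewrite -Er; ring.
have -> : q ^+ (2 * n).+1 = q * (q ^+ n * q ^+ n) by rewrite -exprD -exprS addnn mul2n.
transitivity (q * q ^+ n * (q ^+ n * qbinom (2 * n) n - qbinom (2 * n) n)
    + 2 * q ^+ n.+1 * qbinom (2 * n) n.+1
    - q * (q ^+ (n + 2) * cbin n 2 + q * (q ^+ n * q ^+ n) * qbinom (2 * n) n.+1)).
  by ring.
by rewrite Er !exprS !exprD; ring.
Qed.

(** * The two expansions of the sum *)

Lemma sum_qbinom_classes_2_0 n M : (n <= 3 * M + 1)%N ->
  \sum_(0 <= k < n) q ^+ k.+1 * qbinom (2 * k) k.+1 =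
  \sum_(m < M) (q ^+ ((3 * m + 2) * (2 * m + 1)) * cbin n (3 * m + 2)
              - q ^+ ((6 * m + 7) * (m + 1)) * cbin n (3 * m + 3)).
Proof.
elim: n => [_|n IHn lt_nM].
  by rewrite big_geq // big1 // => m _; rewrite !cbin_gt ?mulr0 ?subr0 //; lia.
rewrite big_nat_recr //= IHn ?(ltnW lt_nM) //; apply/esym/eqP.
rewrite addrC -subr_eq -sumrB; apply/eqP.
(* The increment in [n] of the right side, as a telescoped sum with its remainder. The remainder is
   zero since n < 3M + 1, but keeping it allows an induction on [M] without that bound. *)
transitivity (q ^+ n.+1 * cbin n 1 - q ^+ (6 * M ^ 2 + 4 * M + n + 1) * cbin n (3 * M + 1)); last first.
  by rewrite (@cbin_gt n (3 * M + 1)) ?addn1 ?mulr0 ?subr0 //; lia.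
elim: M {IHn lt_nM} => [|M IHM]; first by rewrite big_ord0 !addn1 subrr.
rewrite big_ord_recr {}IHM /=.
(* The offset solves a(M+1) = a(M) + 4(3M+1) + 6 with a(0) = 1. *)
have := cbin_block_exp n (3 * M + 1) (6 * M ^ 2 + 4 * M + 1).
rewrite -!addnS.
have -> : (6 * M ^ 2 + 4 * M + 1 + (3 * M + 1) = (3 * M + 2) * (2 * M + 1))%N by lia.
have -> : (6 * M ^ 2 + 4 * M + 1 + 3 * (3 * M + 1) + 3 = (6 * M + 7) * (M + 1))%N by lia.
have -> : (6 * M ^ 2 + 4 * M + 1 + n = 6 * M ^ 2 + 4 * M + n + 1)%N by lia.
have -> : (6 * M ^ 2 + 4 * M + n + 1 + 4 * (3 * M + 1) + 6
  = 6 * M.+1 ^ 2 + 4 * M.+1 + n + 1)%N by lia.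
have -> : (3 * M + 4 = 3 * M.+1 + 1)%N by lia.
by move=> ->; rewrite addrA subrK.
Qed.

Lemma sum_qbinom_classes_0_1 n M : (n <= 3 * M + 2)%N ->
  \sum_(0 <= k < n) q ^+ k.+1 * qbinom (2 * k) k.+1 =
  \sum_(m < M.+1) (q ^+ (m * (6 * m - 1)) * cbin n (3 * m)
              - q ^+ ((2 * m + 1) * (3 * m + 1)) * cbin n (3 * m + 1)) - 1.
Proof.
elim: n => [_|n IHn lt_nM].
  rewrite big_geq // big_ord_recl big1 /= => [|m _].
    (* At n = 0 only the term [0, 0] = 1 survives, and the constant -1 cancels it. *)
    by rewrite !muln0 qbinom0 (@cbin_gt 0 1) // !mulr0 subr0 addr0 mulr1 subrr.
  by rewrite !cbin_gt ?mulr0 ?subr0 // lift0; lia.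
rewrite big_nat_recr //= IHn ?(ltnW lt_nM) //; apply/esym/eqP.
rewrite addrAC subr_eq addrNK addrC -subr_eq -sumrB; apply/eqP.
transitivity (q ^+ n.+1 * cbin n 1
    - q ^+ (6 * M ^ 2 + 8 * M + n + 3) * cbin n (3 * M + 2)); last first.
  by rewrite (@cbin_gt n (3 * M + 2)) ?addn1 ?mulr0 ?subr0 //; lia.
elim: M {IHn lt_nM} => [|M IHM].
  rewrite big_ord_recr big_ord0 /= add0r.
  have -> : ((2 * 0 + 1) * (3 * 0 + 1) = 1)%N by [].
  by rewrite -cbin_block0 !muln0 expr0 expr1; ring.
rewrite big_ord_recr {}IHM /=.
have := cbin_block_exp n (3 * M + 2) (6 * M ^ 2 + 8 * M + 3).
have -> : (6 * M ^ 2 + 8 * M + 3 + (3 * M + 2) = M.+1 * (6 * M.+1 - 1))%N.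
  by rewrite mulnBr; lia.
have -> : (6 * M ^ 2 + 8 * M + 3 + 3 * (3 * M + 2) + 3 = (2 * M.+1 + 1) * (3 * M.+1 + 1))%N by lia.
have -> : (6 * M ^ 2 + 8 * M + 3 + n = 6 * M ^ 2 + 8 * M + n + 3)%N by lia.
have -> : (6 * M ^ 2 + 8 * M + n + 3 + 4 * (3 * M + 2) + 6
  = 6 * M.+1 ^ 2 + 8 * M.+1 + n + 3)%N by lia.
have -> : ((3 * M + 2).+1 = 3 * M.+1)%N by lia.
have -> : ((3 * M.+1).+1 = 3 * M.+1 + 1)%N by lia.
have -> : ((3 * M.+1 + 1).+1 = 3 * M.+1 + 2)%N by lia.
by move=> ->; rewrite addrA subrK.
Qed.

(** * Divisibility by the cyclotomic polynomial *)

Lemma qbinom_absorb m k :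
  (1 - q ^+ k.+1) * qbinom m.+1 k.+1 = (1 - q ^+ m.+1) * qbinom m k.
Proof.
have [le_km | lt_mk] := leqP k m; last by rewrite !qbinom_gt // !mulr0.
rewrite qbinomS mulrDr mulrCA qbinom_ratio.
have -> : q ^+ m.+1 = q ^+ k.+1 * q ^+ (m - k) by rewrite -exprD; congr (_ ^+ _); lia.
ring.
Qed.

(** Over the rationals 'Phi_n is the minimal polynomial of [z]; being monic, it is primitive, so
    divisibility descends to integer coefficients. *)
Lemma Cyclotomic_dvd n (p : {poly int}) (z : algC) : n.-primitive_root z ->
  root (map_poly intr p) z -> exists C, p = C * 'Phi_n.
Proof.
move=> prim_z pz0; have [pf [Dpf _] dv_pf] := minCpolyP z.
have ZtoQ (r : {poly int}) : map_poly ratr (map_poly intr r : {poly rat}) = map_poly intr r :> {poly algC}.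
  by rewrite -map_poly_comp; apply: eq_map_poly => b; rewrite /= rmorph_int.
have Epf : pf = map_poly intr 'Phi_n.
  apply: (map_poly_inj (ratr : rat -> algC)).
  by rewrite -Dpf ZtoQ (minCpoly_cyclotomic prim_z) (Cintr_Cyclotomic prim_z).
move: pz0; rewrite -ZtoQ dv_pf Epf dvdp_rat_int => /dvdpP_int[C ->].
by exists C; rewrite zprimitive_monic ?Cyclotomic_monic // mulrC.
Qed.

Lemma Cyclotomic_dvd_Xn_sub_1 n : (0 < n)%N -> exists C, 'X^n - 1 = C * 'Phi_n.
Proof.
move=> n_gt0; have [z prim_z] := C_prim_root_exists n_gt0.
apply: (Cyclotomic_dvd prim_z).
by rewrite rmorphB /= map_polyXn rmorph1 -[root _ _]/(_ == _) !hornerE prim_expr_order ?subrr.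
Qed.

(** At a primitive n-th root of unity the right side of [qbinom_absorb] vanishes, while 1 - z^j does
    not. *)
Lemma Cyclotomic_dvd_qbinom n j : (0 < j < n)%N ->
  exists C, qbinom n j = C * 'Phi_n.
Proof.
case: j => // j; case: n => // n /=; rewrite ltnS => lt_jn.
have [z prim_z] := C_prim_root_exists (ltn0Sn n).
apply: (Cyclotomic_dvd prim_z).
have := congr1 (fun p => (map_poly (intr : int -> algC) p).[z]) (qbinom_absorb n j).
rewrite !rmorphM !rmorphB /= !map_polyXn rmorph1 !hornerE.
rewrite (prim_expr_order prim_z) subrr mul0r => /eqP; rewrite mulf_eq0 subr_eq0.
rewrite eq_sym -(prim_order_dvd prim_z) gtnNdvd //.
Qed.

(** * Congruences modulo 'Phi_n and its square *)

Lemma polyz_congr_refl D A : polyz_congr D A A.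
Proof. by exists 0; rewrite subrr mul0r. Qed.

Lemma polyz_congr_add D A B A' B' :
  polyz_congr D A B -> polyz_congr D A' B' -> polyz_congr D (A + A') (B + B').
Proof.
by move=> [C EC] [C' EC']; exists (C + C'); rewrite mulrDl -EC -EC'; ring.
Qed.

Lemma polyz_congr_sum0 D I (r : seq I) (F : I -> {poly int}) :
  (forall i, polyz_congr D (F i) 0) -> polyz_congr D (\sum_(i <- r) F i) 0.
Proof.
move=> F0; elim/big_rec: _ => [|i A _ A0]; first exact: polyz_congr_refl.
by rewrite -[0]addr0; apply: polyz_congr_add.
Qed.

(** The extreme terms of q-Vandermonde give the right side; each inner term has two binomial factors
    divisible by 'Phi_n. *)
Lemma qbinom_double n k : (0 < k <= n)%N ->
  polyz_congr ('Phi_n ^+ 2) (qbinom (2 * n) k) (qbinom n k * (1 + q ^+ (n * k))).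
Proof.
case: k => // k /= lt_kn; rewrite mul2n -addnn q_Vandermonde.
rewrite big_ord_recr big_ord_recl /= subnn muln0 !qbinom0 !subn0 expr0 mul1r !mulr1.
rewrite addrAC [_ + qbinom n _]addrC -[X in X + _ + _]mulr1 -mulrDr -[X in polyz_congr _ _ X]addr0.
apply: polyz_congr_add; first exact: polyz_congr_refl.
apply: polyz_congr_sum0 => -[i /= lt_ik]; rewrite /bump leq0n add1n.
have [|A ->] := @Cyclotomic_dvd_qbinom n i.+1; first by lia.
have [|B ->] := @Cyclotomic_dvd_qbinom n (k.+1 - i.+1); first by lia.
by exists (A * B * q ^+ ((n - i.+1) * (k.+1 - i.+1))); ring.
Qed.

Lemma polyz_congr_expX n a b : (0 < n)%N -> a = b %[mod n] ->
  polyz_congr 'Phi_n (q ^+ a) (q ^+ b).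
Proof.
move=> n_gt0; wlog le_ba : a b / (b <= a)%N.
  move=> IH; have [/IH//|/ltnW/IH IHba Eab] := leqP b a.
  by have [C EC] := IHba (esym Eab); exists (- C); rewrite mulNr -EC opprB.
move=> /eqP; rewrite eqn_mod_dvd // => /dvdnP[c Ec].
have [C EC] := Cyclotomic_dvd_Xn_sub_1 n_gt0.
exists (q ^+ b * (\sum_(i < c) (q ^+ n) ^+ i) * C).
have -> : forall x y : {poly int}, x * y * C * 'Phi_n = x * (C * 'Phi_n * y) by move=> x y; ring.
by rewrite -EC -subrX1 -exprM [(n * c)%N]mulnC -Ec mulrBr mulr1 -exprD subnKC.
Qed.

(** After [qbinom_double] both terms share the factor [n, j], which supplies one 'Phi_n. The
    cofactor need only vanish modulo the first power, so exponents matter only modulo n. *)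
Lemma cbin_reflect n j j' a b : (j + j' = n)%N -> (0 < j)%N -> (0 < j')%N ->
  a = b %[mod n] ->
  polyz_congr ('Phi_n ^+ 2) (q ^+ a * cbin n j - q ^+ b * cbin n j') 0.
Proof.
move=> Ejj j_gt0 j'_gt0 Eab.
have -> : cbin n j = qbinom (2 * n) j'.
  by rewrite -qbinom_sym; [congr qbinom|]; lia.
have -> : cbin n j' = qbinom (2 * n) j.
  by rewrite -qbinom_sym; [congr qbinom|]; lia.
have [|C EC] := @Cyclotomic_dvd_qbinom n j; first lia.
have [|A EA] := @qbinom_double n j; first lia.
have [|B EB] := @qbinom_double n j'; first lia.
have E : qbinom n j' = qbinom n j by rewrite -qbinom_sym; [congr qbinom|]; lia.
have [|F EF] := @polyz_congr_expX n a b _ Eab; first lia.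
have [||G EG] := @polyz_congr_expX n (a + n * j') (b + n * j); first lia.
  by rewrite [in LHS]addnC [in RHS]addnC ![(n * _)%N]mulnC !modnMDl.
exists (q ^+ a * B - q ^+ b * A + C * (F + G)).
rewrite subr0.
have -> : (q ^+ a * B - q ^+ b * A + C * (F + G)) * 'Phi_n ^+ 2 =
  q ^+ a * (B * 'Phi_n ^+ 2) - q ^+ b * (A * 'Phi_n ^+ 2)
    + (C * 'Phi_n) * (F * 'Phi_n + G * 'Phi_n) by ring.
rewrite -EA -EB -EC -EF -EG E !exprD; ring.
Qed.

(** First-order expansion of (1 + (q^n - 1))^a, as the square of q^n - 1 is divisible by that of
    'Phi_n. *)
Lemma expX_linear n a : (0 < n)%N ->
  polyz_congr ('Phi_n ^+ 2) (q ^+ (n * a)) (1 + a%:R * (q ^+ n - 1)).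
Proof.
move=> n_gt0; have [C EC] := Cyclotomic_dvd_Xn_sub_1 n_gt0.
elim: a => [|a [D ED]].
  by rewrite muln0 mul0r addr0; apply: polyz_congr_refl.
exists (q ^+ n * D + a%:R * C ^+ 2).
have -> : (q ^+ n * D + a%:R * C ^+ 2) * 'Phi_n ^+ 2 =
  q ^+ n * (D * 'Phi_n ^+ 2) + a%:R * (C * 'Phi_n) ^+ 2 by ring.
rewrite -ED -EC mulnS exprD -natr1; ring.
Qed.

Theorem theorem1p2 (n : nat) (hn : (0 < n)%N) :
  (n = 2 %[mod 3] ->
     polyz_congr ('Phi_n ^+ 2)
       (\sum_(0 <= k < n) 'X ^+ k.+1 * qbinom (2 * k) k.+1)
       ('X ^+ ((n * (2 * n - 1)) %/ 3))) /\
  (n = 1 %[mod 3] ->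
     polyz_congr ('Phi_n ^+ 2)
       (\sum_(0 <= k < n) 'X ^+ k.+1 * qbinom (2 * k) k.+1)
       (((n - 1) %/ 3)%:R * ('X ^+ n - 1))).
Proof.
split=> n_mod3; pose N := (n %/ 3)%N.
  have En : (n = 3 * N + 2)%N by rewrite {1}(divn_eq n 3) n_mod3 mulnC.
  have -> : ((n * (2 * n - 1)) %/ 3 = (3 * N + 2) * (2 * N + 1))%N.
    by rewrite -(@mulnK ((3 * N + 2) * (2 * N + 1)) 3) //; congr (_ %/ _)%N; rewrite {}En; lia.
  (* The last index m = N contributes exactly the term j = n, since its partner has j = n + 1. *)
  rewrite (@sum_qbinom_classes_2_0 n N.+1); last by lia.
  rewrite big_ord_recr /= -En.
  have -> : cbin n n = 1 by rewrite addnn -mul2n qbinomnn.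
  rewrite (@cbin_gt n (3 * N + 3)); last by lia.
  rewrite mulr1 mulr0 subr0 -[X in polyz_congr _ _ X]add0r.
  apply: polyz_congr_add; last exact: polyz_congr_refl.
  (* Reversing the second sum pairs j = 3m + 2 with j' = 3(N - m), and j + j' = n. *)
  rewrite sumrB [X in _ - X](reindex_inj rev_ord_inj) -sumrB /=.
  apply: polyz_congr_sum0 => -[m /= lt_mN]; apply: cbin_reflect; try lia.
  have [p Ep] : exists p, (N = m + p.+1)%N by exists (N - m.+1)%N; lia.
  have -> : (N - m.+1 = p)%N by lia.
  apply: (@eq_mod_of_add n (4 * p.+1) (2 * N + 1)); rewrite En Ep; lia.
have En : (n = 3 * N + 1)%N by rewrite {1}(divn_eq n 3) n_mod3 mulnC.
have -> : ((n - 1) %/ 3 = N)%N by rewrite En addnK mulKn.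
rewrite (@sum_qbinom_classes_0_1 n N); last by lia.
(* The terms j = 0 and j = n have no admissible reflection and are split off; the others pair as
   3(m+1) with 3(N-m-1) + 1. *)
rewrite sumrB big_ord_recl [X in _ - X - 1]big_ord_recr /= -En.
have -> : cbin n n = 1 by rewrite addnn -mul2n qbinomnn.
rewrite muln0 expr0 mul1r mulr1 addn0.
set S1 := \sum_(i < N) _; set S2 := \sum_(i < N) _.
have -> : qbinom (2 * n) n + S1 - (S2 + q ^+ ((2 * N + 1) * n)) - 1 =
  (S1 - S2) + (qbinom (2 * n) n - q ^+ ((2 * N + 1) * n) - 1) by ring.
rewrite -[X in polyz_congr _ _ X]add0r; apply: polyz_congr_add.
  rewrite {}/S2 (reindex_inj rev_ord_inj) -sumrB /=.
  apply: polyz_congr_sum0 => -[m /= lt_mN]; rewrite /bump leq0n add1n; apply: cbin_reflect; try lia.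
  have [p Ep] : exists p, (N = m.+1 + p)%N by exists (N - m.+1)%N; lia.
  have -> : (N - m.+1 = p)%N by lia.
  apply: (@eq_mod_of_add n (2 * N + 1) (4 * m.+1)); rewrite En Ep mulnBr; lia.
(* With [2n, n] congruent to 1 + q^(n^2), linearizing both powers leaves the coefficient n - (2N+1)
   = N of q^n - 1. *)
have [|A EA] := @qbinom_double n n; first by rewrite hn leqnn.
have [B EB] := expX_linear n hn.
have [C EC] := expX_linear (2 * N + 1) hn.
exists (A + B - C).
rewrite mulrBl mulrDl -EA -EB -EC qbinomnn [(n * (_ + _))%N]mulnC.
have -> : n%:R = 3 * N%:R + 1 :> {poly int} by rewrite {1}En natrD natrM.
have -> : (2 * N + 1)%:R = 2 * N%:R + 1 :> {poly int} by rewrite natrD natrM.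
ring.
Qed.
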